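(* Let $q\geq 3$ be an integer, let $\tau\geq 0$ be real, and let $\epsilon\in(0,1)$ be small. Set $$R=\min_{\substack{\gamma\in[0,q-1),\ \kappa\in[0,\frac{q-1}{q}),\\ \gamma+\kappa=\tau}}\left[1-(2\gamma-\kappa+1)H_q\!\left(\frac{\gamma}{2\gamma-\kappa+1}\right)+\gamma\log_q(q-1)-H_q(\kappa)\right]-\epsilon .$$ Then for all sufficiently large $n$, with probability at least $1-q^{-n}$, a random insdel code $\mathcal{C}\subseteq\Sigma_q^n$ of rate $R$ is $(\tau n,O(1/\epsilon))$-list-decodable.
   Context: $\Sigma_q$ is a finite alphabet of size $q$. The insdel distance $d(\mathbf a,\mathbf b)$ between words $\mathbf a\in\Sigma_q^{n_1}$, $\mathbf b\in\Sigma_q^{n_2}$ (lengths may differ) is the minimum number of single-symbol insertions and deletions needed to transform $\mathbf a$ into $\mathbf b$. For $\mathbf u\in\Sigma_q^n$ and real $z\ge 0$, the insdel ball is $\mathcal{B}(\mathbf u,z)=\{\mathbf v\in\bigcup_{i=\max\{n-z,0\}}^{n+z}\Sigma_q^i : d(\mathbf u,\mathbf v)\le z\}$. A code $\mathcal{C}\subseteq\Sigma_q^n$ is $(\tau n,L)$-list-decodable if for every nonnegative integer $m\in[\max(0,n-\tau n),n+\tau n]$ and every $\mathbf r\in\Sigma_q^m$, $|\mathcal{B}(\mathbf r,\tau n)\cap\mathcal{C}|\le L$. The rate of $\mathcal{C}$ is $\log_q|\mathcal{C}|/n$. A random insdel code of rate $R$ is a subset of $\Sigma_q^n$ of size $q^{Rn}$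 chosen uniformly at random. $H_q(x)=x\log_q(q-1)-x\log_q x-(1-x)\log_q(1-x)$ for $0<x<1$, with $H_q(0)=H_q(1)=0$. *)

(* Defs.v *)
From HB Require Import structures.
From mathcomp Require Import all_boot all_order all_algebra.
From mathcomp Require Import all_classical all_reals all_analysis.
From mathcomp Require Import Rstruct Rstruct_topology.
Set Implicit Arguments. Unset Strict Implicit. Unset Printing Implicit Defensive.
Import Order.TTheory GRing.Theory Num.Theory.
Local Open Scope ring_scope.
Local Open Scope classical_set_scope.

Notation RR := Rdefinitions.R.

Inductive insdel_step {T : Type} : seq T -> seq T -> Prop :=
| insdel_del (s1 : seq T) (x : T) (s2 : seq T) : insdel_step (s1 ++ x :: s2) (s1 ++ s2)
| insdel_ins (s1 : seq T) (x : T) (s2 : seq T) : insdel_step (s1 ++ s2) (s1 ++ x :: s2).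

Inductive insdel_reach {T : Type} : nat -> seq T -> seq T -> Prop :=
| insdel_reach0 (a : seq T) : insdel_reach 0 a a
| insdel_reachS (k : nat) (a b c : seq T) :
    insdel_step a b -> insdel_reach k b c -> insdel_reach k.+1 a c.

Definition insdel_dist_le {T : Type} (a b : seq T) (z : RR) : Prop :=
  exists k : nat, insdel_reach k a b /\ (k%:R <= z).

Definition in_insdel_ball {T : Type} (u : seq T) (z : RR) (v : seq T) : Prop :=
  Num.max ((size u)%:R - z) 0 <= (size v)%:R <= (size u)%:R + z
  /\ insdel_dist_le u v z.

Definition list_decodable (q n : nat) (rad : RR) (L : nat)
  (C : {set n.-tuple 'I_q}) : Prop :=
  forall m : nat, Num.max 0 (n%:R - rad) <= m%:R <= n%:R + rad ->
  forall r : m.-tuple 'I_q,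
    (#|[set c in C | `[< in_insdel_ball (val r) rad (val c) >] ]| <= L)%N.

Definition logq (q : nat) (x : RR) : RR := ln x / ln q%:R.

Definition Hq (q : nat) (x : RR) : RR :=
  if (0 < x) && (x < 1) then
    x * logq q (q%:R - 1) - x * logq q x - (1 - x) * logq q (1 - x)
  else 0.

Definition rate_obj (q : nat) (g k : RR) : RR :=
  1 - (2 * g - k + 1) * Hq q (g / (2 * g - k + 1)) + g * logq q (q%:R - 1) - Hq q k.

Definition rate_bound (q : nat) (tau : RR) : RR :=
  inf [set x : RR | exists g k : RR,
         [/\ 0 <= g < q%:R - 1, 0 <= k < (q%:R - 1) / q%:R, g + k = tau
           & x = rate_obj q g k]].

(** Codes of size floor(q^(R n)) (a random code is a uniform such subset). *)
Definition code_size (q n : nat) (rate : RR) : nat :=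
  Num.truncn (q%:R `^ (rate * n%:R)).

(* Main.v *)
Require Import Defs.
From HB Require Import structures.
From mathcomp Require Import all_boot all_order all_algebra.
From mathcomp Require Import all_classical all_reals all_analysis.
From mathcomp Require Import Rstruct Rstruct_topology.

From mathcomp Require Import zify ring lra.
Import Order.TTheory GRing.Theory Num.Theory.
Local Open Scope ring_scope.

(** First moment method.  If [c] lies within [tau * n] of [r], the two words have a common
    subsequence of some length [l] with [(m - l) + (n - l) <= tau * n].  Setting
    [k = (n - l) / n] and [g = tau - k], the subsequences of [r] number at most ['C(m, l)] and
    each has at most [q ^ (n * Hq q k)] supersequences of length [n], so the ball around [r]
    has at most [(n + 1) * q ^ (n * (1 - rate_bound))] points of length [n].  A random code
    puts [L + 1] words in it with probability at most [((n + 1) * q ^ (- eps * n)) ^ (L + 1)],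
    which for [L + 1 >= 8 / eps] beats the [q ^ (2 * n + 1)] possible centres.

    This needs [tau < (q - 1) / q]; for larger [tau], letting [k] tend to [(q - 1) / q], where
    [Hq] is 1, shows [rate_bound <= 0], and then the code is empty. *)

(** * Common subsequences of words joined by an edit path *)

(** If the embedding of [s] uses the deleted letter, dropping the letter matched to it repairs the
    embedding; otherwise [s] survives whole. *)
Lemma subseq_del_mid (T : eqType) (s s1 s2 : seq T) (x : T) :
  subseq s (s1 ++ x :: s2) ->
  exists s', [/\ subseq s' s, subseq s' (s1 ++ s2) & (size s <= (size s').+1)%N].
Proof.
elim: s1 s => [|y s1 IH] s /=.
  case: s => [|z s] H; first by exists [::]; split=> //; exact: sub0seq.
  move: H; have [->{z} H|_ H] := eqVneq z x.
    by exists s; split=> //; exact: subseq_cons.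
  by exists (z :: s); split.
case: s => [|z s] H; first by exists [::].
move: H; have [->{z} /IH [s' [H1 H2 H3]]|zy /IH [s' [H1 H2 H3]]] := eqVneq z y.
  by exists (y :: s'); rewrite /= eqxx.
exists s'; split=> //; exact: subseq_trans H2 (subseq_cons _ _).
Qed.

(** Induction from the first edit. A deletion keeps [s], and the step pays for the extra letter of
    [a]. An insertion may cost [s] a letter, so [(size s).*2] drops by at most 2: one unit is paid
    by the step, one by [a] being shorter than [b]. *)
Lemma insdel_reach_common_subseq (T : eqType) (k : nat) (a c : seq T) :
  insdel_reach k a c ->
  exists s, [/\ subseq s a, subseq s c & (size a + size c <= k + (size s).*2)%N].
Proof.
elim=> {k a c} [a|k a b c ab _ [s [sb sc sz]]].
  by exists a; rewrite subseq_refl add0n addnn.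
case: ab sb sz => s1 x s2 sb; rewrite !size_cat /= => sz.
  exists s; split=> //; last by lia.
  exact: subseq_trans sb (cat_subseq (subseq_refl _) (subseq_cons _ _)).
have [s' [H1 H2 H3]] := subseq_del_mid _ _ _ _ _ sb.
exists s'; split=> //; [exact: subseq_trans H1 sc|lia].
Qed.

(** * Enumerating the subsequences of a given length *)

(** Entries correspond to sets of positions, so a subsequence may be repeated and the length of the
    list is exactly a binomial coefficient. *)
Fixpoint subseqs_of_size (T : Type) (r : seq T) (l : nat) : seq (seq T) :=
  match r, l with
  | _, 0 => [:: [::]]
  | [::], _.+1 => [::]
  | x :: r', l'.+1 => map (cons x) (subseqs_of_size T r' l') ++ subseqs_of_size T r' l
  end.

Lemma size_subseqs_of_size (T : Type) (r : seq T) (l : nat) :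
  size (subseqs_of_size T r l) = 'C(size r, l).
Proof.
elim: r l => [|x r IH] [|l] //=.
by rewrite size_cat size_map !IH binS addnC.
Qed.

Lemma mem_subseqs_of_size (T : eqType) (r s : seq T) :
  (s \in subseqs_of_size T r (size s)) = subseq s r.
Proof.
elim: r s => [|x r IH] [|y s] //=; rewrite mem_cat.
have IHy := IH (y :: s); rewrite /= in IHy; rewrite {}IHy.
have [->|ne] := eqVneq y x.
  rewrite mem_map ?IH; last by move=> ? ? [].
  by apply/orP/idP => [[//|]|->]; [apply: subseq_trans (subseq_cons _ _)|left].
suff -> : (y :: s \in map (cons x) (subseqs_of_size T r (size s))) = false by [].
by apply/negP => /mapP [t _ [/eqP]]; rewrite (negPf ne).
Qed.

Lemma size_of_subseqs (T : eqType) (r s : seq T) (l : nat) :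
  s \in subseqs_of_size T r l -> size s = l.
Proof.
elim: r l s => [|x r IH] [|l] s //=; rewrite ?inE; try by move/eqP->.
by rewrite mem_cat => /orP [/mapP [t /IH <- ->]|/IH].
Qed.

Lemma leq_card_bigcup (I : Type) (T : finType) (r : seq I) (P : pred I) (F : I -> {set T}) :
  (#|\bigcup_(i <- r | P i) F i| <= \sum_(i <- r | P i) #|F i|)%N.
Proof.
elim/big_rec2: _ => [|i k A _ H]; first by rewrite cards0.
by apply: leq_trans (leq_card_setU _ _) _; rewrite leq_add2l.
Qed.

(** * Counting supersequences of a fixed length *)

Definition supseqs (T : finType) (n : nat) (s : seq T) : {set n.-tuple T} :=
  [set c : n.-tuple T | subseq s c].

(** Split on the first letter of the longer word: if it is [x], matching it greedily loses nothing
    and [s] remains; any other letter leaves [x :: s] to embed in the tail. *)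
Lemma card_supseqsS (T : finType) (n : nat) (x : T) (s : seq T) :
  #|supseqs T n.+1 (x :: s)| =
  (#|supseqs T n s| + #|T|.-1 * #|supseqs T n (x :: s)|)%N.
Proof.
have cardE m t : #|supseqs T m t| = (\sum_(c : m.-tuple T) subseq t c)%N.
  by rewrite -sum1_card big_mkcond; apply: eq_bigr => c _; rewrite inE; case: ifP.
rewrite 3!cardE (reindex (fun p : T * n.-tuple T => [tuple of p.1 :: p.2])) /=; last first.
  exists (fun c : n.+1.-tuple T => (thead c, [tuple of behead c])) => [[y t] _|c _].
    by congr pair; apply: val_inj.
  by rewrite -tuple_eta.
rewrite -(pair_bigA _ (fun y (t : n.-tuple T) => subseq (x :: s) (y :: t) : nat)) /=.
rewrite (bigD1 x) //= eqxx; congr addn.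
rewrite (eq_bigr (fun=> \sum_(c : n.-tuple T) subseq (x :: s) c)%N); last first.
  by move=> y yx; apply: eq_bigr => c _ /=; rewrite eq_sym (negPf yx).
by rewrite sum_nat_const cardC1.
Qed.

Lemma card_supseqs_size (T : finType) (n : nat) (s : seq T) :
  size s = n -> (#|supseqs T n s| <= 1)%N.
Proof.
move=> sn; apply/card_le1_eqP => c d; rewrite !inE => sc sd.
have E (e : n.-tuple T) : subseq s e -> s = e.
  move=> H; apply/eqP; have [_ <-] := size_subseq_leqif H.
  by rewrite sn size_tuple.
by apply: val_inj; rewrite /= -(E _ sc) -(E _ sd).
Qed.

(* Exponential-moment bound; [lam = k / ((1 - k) * (q - 1))] turns it into [q ^ (n * Hq q k)]
   when [n - size s = k * n]. *)
Lemma card_supseqs_weight (T : finType) (n : nat) (s : seq T) (lam : RR) :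
  (0 < #|T|)%N -> 0 < lam -> lam <= 1 ->
  lam ^+ n * #|supseqs T n s|%:R <= lam ^+ size s * (1 + #|T|.-1%:R * lam) ^+ n.
Proof.
move=> T0 lam0 lam1.
have B0 : 0 <= 1 + #|T|.-1%:R * lam by rewrite addr_ge0 // mulr_ge0 // ltW.
elim: n s => [|n IH] s.
  rewrite !expr0 mul1r mulr1; case: s => [|x s].
    by rewrite expr0 lern1 (leq_trans (max_card _)) // card_tuple expn0.
  rewrite eq_card0 ?exprn_ge0 ?ltW // => c.
  by rewrite inE tuple0.
case: s => [|x s].
  rewrite expr0 mul1r (_ : #|supseqs T n.+1 [::]| = #|T| ^ n.+1)%N; last first.
    by rewrite -card_tuple -cardsT; congr #|pred_of_set _|; apply/setP => c; rewrite !inE sub0seq.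
  rewrite natrX -exprMn lerXn2r ?nnegrE ?mulr_ge0 ?(ltW lam0) //.
  have -> : #|T|%:R = 1 + #|T|.-1%:R :> RR by rewrite -{1}(prednK T0) -addn1 natrD addrC.
  (* With [s] empty all words count, and [lam * #|T| <= 1 + #|T|.-1 * lam] is where [lam <= 1]
     enters. *)
  by rewrite mulrDr mulr1 [lam * _]mulrC lerD2r.
rewrite card_supseqsS natrD natrM.
(* The recurrence weights the two induction hypotheses by [lam] and [#|T|.-1 * lam]; their sum
   produces one more factor [1 + #|T|.-1 * lam]. *)
have H1 := ler_wpM2l (ltW lam0) (IH s).
have H2 := ler_wpM2l (mulr_ge0 (ler0n RR #|T|.-1) (ltW lam0)) (IH (x :: s)).
rewrite /= in H1 H2 *; rewrite [lam ^+ (size s).+1]exprS in H2; rewrite !exprS.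
move: H1 H2; move: (lam ^+ n) (lam ^+ size s) (_ ^+ n) => u v w.
move: (_%:R) (_%:R) (_%:R) => A B C; lra.
Qed.

(** * Random sets of fixed size meeting a given set *)

(** Union bound over the [k]-subsets [S] of [B] contained in [C]: once [S] is chosen, [C :\: S] is
    an [(M - k)]-subset of the complement of [S] and determines [C]. *)
Lemma card_draws_inter (T : finType) (B : {set T}) (M k : nat) : (k <= M)%N ->
  (#|[set C : {set T} | (#|C| == M) && (k <= #|C :&: B|)%N]|
     <= 'C(#|B|, k) * 'C(#|T| - k, M - k))%N.
Proof.
move=> kM.
pose D := [set S : {set T} | S \subset B & #|S| == k].
pose F (S : {set T}) := [set C : {set T} | S \subset C & #|C| == M].
have sub : [set C : {set T} | (#|C| == M) && (k <= #|C :&: B|)%N] \subset \bigcup_(S in D) F S.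
  apply/fintype.subsetP => C; rewrite inE => /andP [cM].
  rewrite -bin_gt0 -cards_draws => /card_gt0P [S]; rewrite inE finset.subsetI => /andP [/andP [SC SB] Sk].
  by apply/finset.bigcupP; exists S; rewrite inE ?SB ?Sk ?SC ?cM.
apply: leq_trans (subset_leq_card sub) _.
apply: leq_trans (leq_card_bigcup _ _ _ _ _) _.
rewrite -cards_draws -sum_nat_const; apply: leq_sum => S; rewrite inE => /andP [_ /eqP Sk].
have <- : #|~: S| = (#|T| - k)%N by rewrite cardsCs finset.setCK Sk.
rewrite -cards_draws -(card_in_imset (f := fun C => C :\: S)) /=; last first.
  move=> C C'; rewrite !inE => /andP [sC _] /andP [sC' _] E.
  by rewrite -(finset.setID C S) -(finset.setID C' S) E (finset.setIidPr sC) (finset.setIidPr sC').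
apply/subset_leq_card/fintype.subsetP => X /imsetP [C]; rewrite !inE => /andP [sC /eqP cM] ->.
by rewrite finset.setDE finset.subsetIr /= -finset.setDE cardsD (finset.setIidPr sC) cM Sk eqxx.
Qed.

(** The quotient of the two binomials is the product of [(M - i) / (Q - i)] for [i < k], and each
    factor is at most [M / Q] because [M <= Q]. *)
Lemma bin_sub_ratio (Q M k : nat) : (k <= M)%N -> (M <= Q)%N -> (0 < Q)%N ->
  'C(Q - k, M - k)%:R <= 'C(Q, M)%:R * (M%:R / Q%:R) ^+ k :> RR.
Proof.
move=> kM MQ Q0; elim: k kM => [|k IH] kM; first by rewrite !subn0 expr0 mulr1.
have /IH {}IH : (k <= M)%N by lia.
have E : ((Q - k) * 'C(Q - k.+1, M - k.+1) = (M - k) * 'C(Q - k, M - k))%N.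
  have -> : (Q - k = (Q - k.+1).+1)%N by lia.
  have -> : (M - k = (M - k.+1).+1)%N by lia.
  exact: mul_bin_diag.
have Qk : 0 < (Q - k)%:R :> RR by rewrite ltr0n; lia.
have Q0' : 0 < Q%:R :> RR by rewrite ltr0n.
have -> : 'C(Q - k.+1, M - k.+1)%:R = 'C(Q - k, M - k)%:R * ((M - k)%:R / (Q - k)%:R) :> RR.
  by apply: (mulfI (lt0r_neq0 Qk)); rewrite -natrM E natrM; field; apply: lt0r_neq0.
rewrite exprSr [leRHS]mulrA; apply: ler_pM => //.
rewrite ler_pdivrMr // mulrAC ler_pdivlMr // -!natrM ler_nat.
nia.
Qed.

Lemma leq_bin_exp (n k : nat) : ('C(n, k) <= n ^ k)%N.
Proof.
elim: k n => [|k IH] n; first by rewrite bin0.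
case: n => [|n]; first by rewrite bin0n.
apply: (@leq_trans (k.+1 * 'C(n.+1, k.+1))); first exact: leq_pmull.
rewrite -mul_bin_diag expnS leq_mul2l (leq_trans (IH n)) ?orbT //.
by case: k {IH} => [|k] //; rewrite leq_exp2r ?leqnSn.
Qed.

(** Read as a probability: a uniform [M]-subset has at least [k] points in [B] with probability at
    most [(#|B| * M / #|T|) ^ k]. *)
Lemma card_draws_inter_ratio (T : finType) (B : {set T}) (M k : nat) : (0 < #|T|)%N ->
  #|[set C : {set T} | (#|C| == M) && (k <= #|C :&: B|)%N]|%:R
    <= 'C(#|T|, M)%:R * (#|B|%:R * M%:R / #|T|%:R) ^+ k :> RR.
Proof.
move=> T0.
have R0 : 0 <= 'C(#|T|, M)%:R * (#|B|%:R * M%:R / #|T|%:R) ^+ k :> RR.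
  by rewrite mulr_ge0 // exprn_ge0 // divr_ge0 // mulr_ge0.
have [/andP [kM MT]|H] := boolP ((k <= M) && (M <= #|T|))%N; last first.
  rewrite eq_card0 // => C; rewrite inE; apply/negbTE; apply: contra H.
  case/andP => /eqP <- kC; rewrite max_card andbT.
  by apply: leq_trans kC (subset_leq_card (finset.subsetIl _ _)).
apply: (@le_trans _ _ ('C(#|B|, k) * 'C(#|T| - k, M - k))%:R).
  by rewrite ler_nat card_draws_inter.
rewrite natrM -mulrA exprMn mulrCA; apply: ler_pM => //; last exact: bin_sub_ratio.
by rewrite -natrX ler_nat leq_bin_exp.
Qed.

(** * Entropy and the rate function in natural logarithms *)

(** Binary entropy in nats. *)
Definition nat_entropy (x : RR) : RR := - (x * ln x) - (1 - x) * ln (1 - x).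

Lemma nat_entropy0 : nat_entropy 0 = 0.
Proof. by rewrite /nat_entropy subr0 ln1; ring. Qed.

Lemma nat_entropy_ge0 (x : RR) : 0 <= x -> x < 1 -> 0 <= nat_entropy x.
Proof.
move=> x0 x1; rewrite /nat_entropy.
have H1 : x * ln x <= 0 by rewrite mulr_ge0_le0 // ln_le0 // ltW.
have H2 : (1 - x) * ln (1 - x) <= 0 by rewrite mulr_ge0_le0 ?ln_le0 //; lra.
lra.
Qed.

Lemma lnq_gt0 (q : nat) : (3 <= q)%N -> 0 < ln (q%:R : RR).
Proof. by move=> q3; apply: ln_gt0; rewrite ltr1n; lia. Qed.

Lemma Hq_lnq (q : nat) (x : RR) : (3 <= q)%N -> 0 <= x -> x < 1 ->
  Hq q x * ln q%:R = x * ln (q%:R - 1) + nat_entropy x.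
Proof.
move=> q3 x0 x1; have L := lt0r_neq0 (lnq_gt0 q q3).
rewrite /Hq /logq /nat_entropy x1 andbT; have [xp|xn] := ltP 0 x; first by field.
have -> : x = 0 by lra.
by rewrite subr0 ln1; ring.
Qed.

(** The term [g * logq q (q - 1)] cancels the [ln (q - 1)] part of the first [Hq]. What remains is
    the exponent for choosing a subsequence of the centre plus the exponent for extending it to a
    codeword. *)
Lemma rate_obj_lnq (q : nat) (g k : RR) : (3 <= q)%N -> 0 <= g -> 0 <= k -> k < 1 ->
  (1 - rate_obj q g k) * ln q%:R =
  (2 * g - k + 1) * nat_entropy (g / (2 * g - k + 1))
  + (k * ln (q%:R - 1) + nat_entropy k).
Proof.
move=> q3 g0 k0 k1; have L := lt0r_neq0 (lnq_gt0 q q3).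
have N0 : 0 < 2 * g - k + 1 by lra.
rewrite -Hq_lnq //; set N := 2 * g - k + 1 in N0 *.
rewrite (_ : nat_entropy (g / N) = Hq q (g / N) * ln q%:R - g / N * ln (q%:R - 1)); last first.
  rewrite Hq_lnq //; [ring|by rewrite divr_ge0 // ltW|].
  by rewrite ltr_pdivrMr // mul1r /N; lra.
by rewrite /rate_obj -/N /logq; field; rewrite L lt0r_neq0.
Qed.

Lemma rate_obj_le (q : nat) (g k : RR) :
  (3 <= q)%N -> 0 <= g -> 0 <= k -> k < 1 -> rate_obj q g k <= 1 - Hq q k.
Proof.
move=> q3 g0 k0 k1; have N0 : 0 < 2 * g - k + 1 by lra.
have H : 0 <= (2 * g - k + 1) * nat_entropy (g / (2 * g - k + 1)).
  rewrite mulr_ge0 ?(ltW N0) // nat_entropy_ge0 ?divr_ge0 ?(ltW N0) //.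
  by rewrite ltr_pdivrMr // mul1r; lra.
rewrite -(ler_pM2r (lnq_gt0 q q3)).
have := rate_obj_lnq q _ _ q3 g0 k0 k1; have := Hq_lnq q k q3 k0 k1; lra.
Qed.

Lemma ln_q_sub1 (q : nat) : (3 <= q)%N ->
  ln ((q%:R - 1) / q%:R) = ln (q%:R - 1) - ln q%:R :> RR.
Proof.
move=> q3; have q0 : 0 < q%:R :> RR by rewrite ltr0n; lia.
by rewrite ln_div ?posrE // subr_gt0 ltr1n; lia.
Qed.

(* [Hq] attains its maximum 1 at [(q - 1) / q]; both logarithms are estimated by
   [ln y <= y - 1] there. *)
Lemma Hq_near_max (q : nat) (k : RR) : (3 <= q)%N -> 0 <= k -> k < (q%:R - 1) / q%:R ->
  1 - q%:R * ((q%:R - 1) / q%:R - k) / ln q%:R <= Hq q k.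
Proof.
move=> q3 k0 kk; have q0 : 0 < q%:R :> RR by rewrite ltr0n; lia.
set k0' := (q%:R - 1) / q%:R in kk *.
have E : 1 - k0' = q%:R^-1 by rewrite /k0'; field; apply: lt0r_neq0.
have qi : 0 < q%:R^-1 :> RR by rewrite invr_gt0.
have k1 : k < 1 by lra.
rewrite -(ler_pM2r (lnq_gt0 q q3)) Hq_lnq // mulrBl mul1r divfK ?(lt0r_neq0 (lnq_gt0 q q3)) // /nat_entropy.
(* Monotonicity of [ln] is enough here, with [k = 0] treated apart. *)
have H1 : k * ln k <= k * (ln (q%:R - 1) - ln q%:R).
  have [->|kn] := eqVneq k 0; first by rewrite !mul0r.
  have kp : 0 < k by rewrite lt0r kn.
  by rewrite -(ln_q_sub1 q q3) ler_wpM2l // ler_ln ?posrE // ?(lt_trans kp kk) // ltW.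
have H2 : ln (1 - k) <= q%:R * (k0' - k) - ln q%:R.
  have -> : 1 - k = (1 + q%:R * (k0' - k)) * q%:R^-1.
    by rewrite /k0'; field; apply: lt0r_neq0.
  have P : 0 < q%:R * (k0' - k) by rewrite mulr_gt0 // subr_gt0.
  rewrite lnM ?lnV ?posrE //; last by lra.
  by rewrite lerB // le_ln1Dx //; lra.
have H3 : (1 - k) * ln (1 - k) <= (1 - k) * (q%:R * (k0' - k) - ln q%:R).
  by rewrite ler_wpM2l //; lra.
have H4 : 0 <= k * (q%:R * (k0' - k)) by rewrite !mulr_ge0 // ?ltW // subr_gt0.
move: H4 H3 H1; move: (ln q%:R) (ln (q%:R - 1)) (ln (1 - k)) (ln k) (q%:R * _) => a b c d e; lra.
Qed.

(** * Exponential bounds for the counts and for the insdel ball *)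

Lemma expr_expR_ln (x : RR) (n : nat) : 0 < x -> x ^+ n = expR (n%:R * ln x).
Proof. by move=> x0; rewrite expRM_natl lnK. Qed.

(** A single term of the binomial expansion of [((1 - x) + x) ^ (l + a) = 1] is at most 1. The
    parameter [x] is left free so that it can be fixed independently of [a] and [l]. *)
Lemma bin_le_expR (a l : nat) (x : RR) : 0 < x -> x < 1 ->
  'C(l + a, l)%:R <= expR (- (a%:R * ln x) - l%:R * ln (1 - x)) :> RR.
Proof.
move=> x0 x1; have y0 : 0 < 1 - x by lra.
have W : 'C(l + a, l)%:R * x ^+ a * (1 - x) ^+ l <= 1.
  have := exprDn (1 - x) x (l + a); rewrite subrK expr1n => E; rewrite [leRHS]E.
  have al : (a < (l + a).+1)%N by lia.
  rewrite (bigD1 (Ordinal al)) //= -[leLHS]addr0 lerD //; last first.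
    by apply: sumr_ge0 => i _; rewrite mulrn_wge0 // mulr_ge0 // exprn_ge0 // ltW.
  rewrite addnK -[leRHS]mulr_natl -[X in 'C(_, X)](addnK a l) bin_sub ?leq_addl //.
  by rewrite [leRHS]mulrA mulrAC.
rewrite -opprD expRN exp.expRD -!expr_expR_ln // -[leRHS]mul1r ler_pdivlMr ?mulrA //.
by rewrite mulr_gt0 // exprn_gt0.
Qed.

Lemma card_supseqs_entropy (q n l : nat) (s : seq 'I_q) (k : RR) :
  (3 <= q)%N -> (0 < n)%N -> (l <= n)%N -> size s = l ->
  k = (n - l)%:R / n%:R -> k < (q%:R - 1) / q%:R ->
  #|supseqs 'I_q n s|%:R <= expR (n%:R * (k * ln (q%:R - 1) + nat_entropy k)).
Proof.
move=> q3 n0 lln sl kE kq.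
have q0 : 0 < q%:R :> RR by rewrite ltr0n; lia.
have q1 : 0 < q%:R - 1 :> RR by rewrite subr_gt0 ltr1n; lia.
have nR : 0 < n%:R :> RR by rewrite ltr0n.
have k0 : 0 <= k by rewrite kE divr_ge0.
have nk : n%:R * k = n%:R - l%:R by rewrite kE natrB //; field; apply: lt0r_neq0.
(* At [k = 0] the weight [lam] would vanish; there [l = n] and at most one word qualifies. *)
have [kz|kn] := eqVneq k 0.
  have ln' : l = n by apply/eqP; rewrite -(eqr_nat RR) -subr_eq0 -opprB -nk kz mulr0 oppr0.
  rewrite kz nat_entropy0 mul0r addr0 mulr0 exp.expR0.
  by rewrite lern1 card_supseqs_size // sl.
have kp : 0 < k by rewrite lt0r kn.
have kq' : k * q%:R < q%:R - 1 by rewrite -ltr_pdivlMr.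
have k1 : k < 1 by rewrite -(ltr_pM2r q0); lra.
have k1' : 0 < 1 - k by lra.
pose lam := k / ((1 - k) * (q%:R - 1)).
have lam0 : 0 < lam by rewrite divr_gt0 // mulr_gt0.
(* Equivalent to [k * q <= q - 1]. *)
have lam1 : lam <= 1 by rewrite ler_pdivrMr ?mulr_gt0 //; lra.
have := card_supseqs_weight 'I_q n s lam; rewrite card_ord sl.
have -> : q.-1%:R = q%:R - 1 :> RR by rewrite -subn1 natrB //; lia.
have -> : 1 + (q%:R - 1) * lam = (1 - k)^-1.
  by rewrite /lam; field; rewrite !lt0r_neq0.
have -> // : lam ^+ l * (1 - k)^-1 ^+ n =
   lam ^+ n * expR (n%:R * (k * ln (q%:R - 1) + nat_entropy k)).
  rewrite !expr_expR_ln ?invr_gt0 // -!exp.expRD; congr expR.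
  rewrite lnV ?posrE // /lam ln_div ?posrE ?mulr_gt0 // lnM ?posrE //.
  have -> : l%:R = n%:R - n%:R * k by rewrite nk; ring.
  by rewrite /nat_entropy; ring.
by move=> H; move: (H (ltnW (ltnW q3)) lam0 lam1); rewrite ler_pM2l // exprn_gt0.
Qed.

(** Take [x = g / (2 * g - k + 1)] in [bin_le_expR]. Both logarithms are nonpositive, so the bound
    only grows when [m - l] is raised to [n * g] and [l = n * (1 - k)] to [n * (1 - k + g)]; these
    two sum to [n * (2 * g - k + 1)]. *)
Lemma bin_le_entropy (n m l : nat) (g k : RR) :
  (l <= m)%N -> n%:R * (1 - k) = l%:R -> k < 1 -> 0 <= g ->
  (m - l)%:R <= n%:R * g ->
  'C(m, l)%:R <= expR (n%:R * ((2 * g - k + 1) * nat_entropy (g / (2 * g - k + 1)))).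
Proof.
move=> lm nk k1 g0 ag.
set a := (m - l)%N in ag; have -> : m = (l + a)%N by rewrite /a subnKC.
have [gz|gn] := eqVneq g 0.
  have a0 : a = 0%N by apply/eqP; move: ag; rewrite gz mulr0 lern0.
  rewrite gz mul0r nat_entropy0 !mulr0 exp.expR0.
  by rewrite a0 addn0 binn.
have gp : 0 < g by rewrite lt0r gn.
have N0 : 0 < 2 * g - k + 1 by lra.
set N := 2 * g - k + 1 in N0 *; set x := g / N.
have x0 : 0 < x by rewrite divr_gt0.
have x1 : x < 1 by rewrite ltr_pdivrMr // mul1r /N; lra.
apply: le_trans (bin_le_expR a l x x0 x1) _; rewrite ler_expR /nat_entropy.
have gE : g = N * x by rewrite /x; field; apply: lt0r_neq0.
have L1 : ln x <= 0 by rewrite ln_le0 // ltW.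
have L2 : ln (1 - x) <= 0 by rewrite ln_le0 //; lra.
have H1 : - (a%:R * ln x) <= - (n%:R * g * ln x) by rewrite lerN2 ler_wnM2r.
have H2 : - (l%:R * ln (1 - x)) <= - (n%:R * (N - g) * ln (1 - x)).
  rewrite lerN2 ler_wnM2r // -nk ler_wpM2l // /N; lra.
apply: le_trans (lerD H1 H2) _; rewrite le_eqVlt; apply/orP; left; apply/eqP.
by rewrite gE; ring.
Qed.

Lemma card_insdel_ball (q n m : nat) (tau R0 : RR) (r : m.-tuple 'I_q) :
  (3 <= q)%N -> (0 < n)%N -> tau < (q%:R - 1) / q%:R ->
  (forall k, 0 <= k -> k <= tau -> R0 <= rate_obj q (tau - k) k) ->
  #|[set c : n.-tuple 'I_q | `[< insdel_dist_le (val r) (val c) (tau * n%:R) >]]|%:R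
    <= n.+1%:R * expR (n%:R * ((1 - R0) * ln q%:R)).
Proof.
move=> q3 n0 tq HR.
have q0 : 0 < q%:R :> RR by rewrite ltr0n; lia.
have nR : 0 < n%:R :> RR by rewrite ltr0n.
(* The lengths allowed by [insdel_reach_common_subseq]. *)
pose cond (l : 'I_n.+1) := (l <= m)%N && ((m + n)%:R <= tau * n%:R + l.*2%:R).
have sub : [set c : n.-tuple 'I_q | `[< insdel_dist_le (val r) (val c) (tau * n%:R) >]]
   \subset \bigcup_(l < n.+1 | cond l) \bigcup_(s <- subseqs_of_size _ r l) supseqs 'I_q n s.
  apply/fintype.subsetP => c; rewrite inE => /asboolP [k [kr kt]].
  have [s [sr sc sz]] := insdel_reach_common_subseq _ _ _ _ kr.
  have sm := size_subseq sr; have sn := size_subseq sc.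
  rewrite /= !size_tuple in sm sn sz.
  have sn' : (size s < n.+1)%N by [].
  apply/finset.bigcupP; exists (Ordinal sn').
    rewrite /cond /= sm /=; apply: le_trans (_ : (k + (size s).*2)%:R <= _).
      by rewrite ler_nat.
    by rewrite natrD lerD2r.
  have : s \in subseqs_of_size _ r (size s) by rewrite mem_subseqs_of_size.
  rewrite /=; elim: (subseqs_of_size _ _ _) => [//|t S IH].
  rewrite big_cons !inE => /orP [/eqP <-|/IH ->]; last by rewrite orbT.
  by rewrite sc.
apply: (@le_trans _ _ (\sum_(l < n.+1) expR (n%:R * ((1 - R0) * ln q%:R)))); last first.
  by rewrite sumr_const card_ord -[leLHS]mulr_natl.
apply: (@le_trans _ _ (\sum_(l < n.+1 | cond l)
   #|\bigcup_(s <- subseqs_of_size _ r l) supseqs 'I_q n s|)%:R).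
  by rewrite ler_nat; apply: leq_trans (subset_leq_card sub) (leq_card_bigcup _ _ _ _ _).
rewrite natr_sum big_mkcond /=; apply: ler_sum => l _.
case: ifP => [/andP [lm lt]|_]; last exact: expR_ge0.
have lln : (l <= n)%N by rewrite -ltnS.
pose k : RR := (n - l)%:R / n%:R.
have nk : n%:R * k = n%:R - l%:R by rewrite /k natrB //; field; apply: lt0r_neq0.
have k0 : 0 <= k by rewrite divr_ge0.
rewrite -addnn !natrD in lt.
(* From [l <= m], the deletions on the codeword side alone already fit in [tau * n]. *)
have kt : k <= tau.
  have : l%:R <= m%:R :> RR by rewrite ler_nat.
  by move=> lmR; rewrite -(ler_pM2l nR) nk; lra.
have kq : k < (q%:R - 1) / q%:R by apply: le_lt_trans tq.
have k1 : k < 1 by apply: lt_trans kq _; rewrite ltr_pdivrMr //; lra.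
have g0 : 0 <= tau - k by rewrite subr_ge0.
apply: (@le_trans _ _ (expR (n%:R * ((1 - rate_obj q (tau - k) k) * ln q%:R)))); last first.
  rewrite ler_expR ler_pM2l // ler_pM2r ?lnq_gt0 // lerD2l lerN2; exact: HR.
rewrite rate_obj_lnq // mulrDr exp.expRD.
apply: (@le_trans _ _ (\sum_(s <- subseqs_of_size _ r l)
   expR (n%:R * (k * ln (q%:R - 1) + nat_entropy k)))).
  apply: (@le_trans _ _ (\sum_(s <- subseqs_of_size _ r l) #|supseqs 'I_q n s|)%:R).
    by rewrite ler_nat leq_card_bigcup.
  rewrite natr_sum big_seq [leRHS]big_seq; apply: ler_sum => s /size_of_subseqs sl.
  exact: (card_supseqs_entropy q n l).
rewrite big_const_seq count_predT size_subseqs_of_size size_tuple iter_addr addr0.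
rewrite -[leLHS]mulr_natl ler_pM2r ?expR_gt0 //; apply: bin_le_entropy => //.
- by rewrite mulrBr nk; lra.
- by rewrite natrB // mulrBr nk; lra.
Qed.

(** * Growth estimates and the size of the code *)

Lemma sum_expn_leq (q k : nat) : (2 <= q)%N -> (\sum_(m < k) q ^ m <= q ^ k)%N.
Proof.
move=> q2; elim: k => [|k IH]; first by rewrite big_ord0.
rewrite big_ord_recr /= expnS; apply: leq_trans (leq_add IH (leqnn _)) _.
by rewrite addnn -mul2n leq_mul2r q2 orbT.
Qed.

(** Squaring [1 + y / 2 <= expR (y / 2)] for [y = t * n] yields the quadratic term
    [n * (n * t ^ 2) / 4], which is at least [n] once [n * t ^ 2 >= 4]. *)
Lemma linear_le_expR (t : RR) : 0 < t ->
  exists N : nat, forall n : nat, (N <= n)%N -> n.+1%:R <= expR (t * n%:R).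
Proof.
move=> t0; exists (Num.truncn (4 / t ^+ 2)).+1 => n nN.
have t2 : 0 < t ^+ 2 by rewrite exprn_gt0.
have H : 4 <= n%:R * t ^+ 2.
  rewrite -ler_pdivrMr //; apply: le_trans (ltW (truncnS_gt _)) _.
  by rewrite ler_nat.
have n0 : 0 <= n%:R :> RR by [].
have -> : t * n%:R = t * n%:R / 2 + t * n%:R / 2 by field.
have E1 := expR_ge1Dx (t * n%:R / 2).
have p0 : 0 <= t * n%:R by rewrite mulr_ge0 // ltW.
rewrite exp.expRD; apply: (@le_trans _ _ ((1 + t * n%:R / 2) * (1 + t * n%:R / 2))).
  rewrite -addn1 natrD; nra.
by apply: ler_pM => //; lra.
Qed.

Lemma code_size0 (q n : nat) (R : RR) : (2 <= q)%N -> (0 < n)%N -> R < 0 ->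
  code_size q n R = 0%N.
Proof.
move=> q2 n0 R0; apply/eqP; rewrite -leqn0 truncn_le_nat /powR.
have -> : (q%:R == 0 :> RR) = false by rewrite pnatr_eq0; apply/negbTE; lia.
rewrite -[ltRHS]exp.expR0 ltr_expR nmulr_rlt0; last by rewrite nmulr_rlt0 ?ltr0n.
by rewrite ln_gt0 // ltr1n.
Qed.

Lemma code_size_le (q n : nat) (R : RR) : (2 <= q)%N ->
  (code_size q n R)%:R <= expR (n%:R * (R * ln q%:R)).
Proof.
move=> q2; rewrite /code_size.
have -> : expR (n%:R * (R * ln q%:R)) = q%:R `^ (R * n%:R).
  rewrite /powR (_ : (q%:R == 0 :> RR) = false); last by rewrite pnatr_eq0; apply/negbTE; lia.
  by congr expR; ring.
by rewrite truncn_le // powR_ge0.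
Qed.

(** * The infimum defining the rate *)

Lemma rate_bound_le0 (q : nat) (tau : RR) : (3 <= q)%N ->
  (q%:R - 1) / q%:R <= tau -> tau < (q%:R - 1) + (q%:R - 1) / q%:R ->
  rate_bound q tau <= 0.
Proof.
move=> q3 t1 t2; rewrite /rate_bound; set S := [set x | _]%classic.
have q0 : 0 < q%:R :> RR by rewrite ltr0n; lia.
have q1 : 0 < q%:R - 1 :> RR by rewrite subr_gt0 ltr1n; lia.
have L := lnq_gt0 q q3.
(* Without an infimum, [inf] takes the default value 0 and the claim is immediate. *)
have [HS|/inf_out ->//] := pselect (has_inf S).
set k0 := (q%:R - 1) / q%:R in t1 t2.
have kp : 0 < k0 by rewrite divr_gt0.
have k01 : k0 < 1 by rewrite ltr_pdivrMr //; lra.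
apply/ler_addgt0Pr => e e0; rewrite add0r.
(* For [k = k0 - d], the three bounds give in turn [k >= 0], [tau - k < q - 1], and a defect in
   [Hq_near_max] of at most [e]. *)
pose d := Num.min (Num.min k0 ((k0 - (tau - (q%:R - 1))) / 2)) (e * ln q%:R / q%:R).
have d0 : 0 < d.
  rewrite !lt_min kp /= !divr_gt0 ?mulr_gt0 //; lra.
have d1 : d <= k0 by rewrite /d !ge_min lexx.
have d2 : d <= (k0 - (tau - (q%:R - 1))) / 2 by rewrite /d !ge_min lexx orbT.
have d3 : d <= e * ln q%:R / q%:R by rewrite /d !ge_min lexx orbT.
apply: (@le_trans _ _ (rate_obj q (tau - (k0 - d)) (k0 - d))).
  apply: ge_inf; first by case: HS.
  exists (tau - (k0 - d)), (k0 - d); split=> //; last by ring.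
    by apply/andP; split; lra.
  by apply/andP; split; rewrite -?/k0; lra.
apply: le_trans (rate_obj_le q _ _ q3 _ _ _) _; try lra.
have := Hq_near_max q (k0 - d) q3; rewrite -/k0 => H.
have {H} : 1 - q%:R * (k0 - (k0 - d)) / ln q%:R <= Hq q (k0 - d) by apply: H; lra.
have -> : k0 - (k0 - d) = d by ring.
have : q%:R * d / ln q%:R <= e.
  by rewrite ler_pdivrMr // mulrC -ler_pdivlMr.
lra.
Qed.

(** Positivity of [rate_bound] excludes the default value 0 of [inf], so the set is bounded below;
    since [tau < (q - 1) / q], every [k] in [[0, tau]] is admissible. *)
Lemma rate_bound_le_obj (q : nat) (tau k : RR) : (3 <= q)%N ->
  tau < (q%:R - 1) / q%:R -> 0 < rate_bound q tau -> 0 <= k -> k <= tau ->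
  rate_bound q tau <= rate_obj q (tau - k) k.
Proof.
move=> q3 t1; rewrite /rate_bound; set S := [set x | _]%classic => S0 k0 kt.
have q0 : 0 < q%:R :> RR by rewrite ltr0n; lia.
have q1 : 1 <= q%:R - 1 :> RR by rewrite lerBrDr (_ : 1 + 1 = 2%:R) // ler_nat; lia.
have H : (q%:R - 1) / q%:R < 1 :> RR by rewrite ltr_pdivrMr //; lra.
apply: ge_inf.
  have [[_ //]|/inf_out E] := pselect (has_inf S).
  by rewrite E ltxx in S0.
by exists (tau - k), k; split=> //; [apply/andP; split; lra|rewrite k0 /=; lra|ring].
Qed.

(** * Union bound over the centres *)

(** A violating centre has length at most [n + tau * n <= 2 * n], so the centres range over a finite
    family. *)
Lemma not_list_decodable (q n L : nat) (tau : RR) (C : {set n.-tuple 'I_q}) :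
  tau < 1 -> ~ list_decodable (tau * n%:R) L C ->
  exists (m : 'I_(n.*2.+1)) (r : m.-tuple 'I_q),
    (L < #|C :&: [set c : n.-tuple 'I_q | `[< insdel_dist_le (val r) (val c) (tau * n%:R)%R >]]|)%N.
Proof.
move=> t1 /existsNP [m] /not_implyP [/andP [_ mn]] /existsNP [r] /negP.
rewrite -ltnNge => Lr.
have mlt : (m < n.*2.+1)%N.
  rewrite ltnS -(ler_nat RR); apply: le_trans mn _.
  rewrite -addnn natrD lerD2l -[leRHS]mul1r ler_wpM2r // ltW //.
exists (Ordinal mlt), r; apply: leq_trans Lr _; apply: subset_leq_card.
apply/fintype.subsetP => c; rewrite !inE => /andP [-> /asboolP [_ H]] /=.
exact/asboolP.
Qed.

(** A bad code has [L + 1] words near some centre. Each centre is handled by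
    [card_draws_inter_ratio], and there are at most [q ^ (2 * n + 1)] centres. *)
Lemma card_not_list_decodable (q n L M : nat) (tau V : RR) : (3 <= q)%N -> tau < 1 ->
  (forall m (r : m.-tuple 'I_q),
    #|[set c : n.-tuple 'I_q | `[< insdel_dist_le (val r) (val c) (tau * n%:R) >]]|%:R <= V) ->
  #|[set C : {set n.-tuple 'I_q} | (#|C| == M) && ~~ `[< list_decodable (tau * n%:R) L C >]]|%:R
   <= q%:R ^+ n.*2.+1 * ('C(q ^ n, M)%:R * (V * M%:R / q%:R ^+ n) ^+ L.+1) :> RR.
Proof.
move=> q3 t1 HV; have q0 : (0 < q)%N by lia.
pose B m (r : m.-tuple 'I_q) := [set c : n.-tuple 'I_q |
  `[< insdel_dist_le (val r) (val c) (tau * n%:R) >]].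
pose D m (r : m.-tuple 'I_q) := [set C : {set n.-tuple 'I_q} |
  (#|C| == M) && (L.+1 <= #|C :&: B m r|)%N].
set X := (X in _ <= _ * X).
have cT : #|{: n.-tuple 'I_q}| = (q ^ n)%N by rewrite card_tuple card_ord.
have HD m (r : m.-tuple 'I_q) : #|D m r|%:R <= X.
  apply: le_trans (card_draws_inter_ratio _ _ _ _ _) _; first by rewrite cT expn_gt0 q0.
  rewrite cT natrX ler_wpM2l // lerXn2r ?nnegrE ?divr_ge0 ?mulr_ge0 //.
    by apply: (le_trans _ (HV m r)).
  by apply: ler_wpM2r; rewrite ?invr_ge0 ?exprn_ge0 //; apply: ler_wpM2r => //; exact: HV.
have X0 : 0 <= X.
  rewrite /X mulr_ge0 // exprn_ge0 // divr_ge0 // mulr_ge0 //.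
  by apply: (le_trans _ (HV 0%N [tuple])).
have sub : [set C : {set n.-tuple 'I_q} | (#|C| == M) && ~~ `[< list_decodable (tau * n%:R) L C >]]
   \subset \bigcup_(m < n.*2.+1) \bigcup_(r : m.-tuple 'I_q) D m r.
  apply/fintype.subsetP => C; rewrite inE => /andP [CM /asboolPn /not_list_decodable [//|m [r H]]].
  by apply/finset.bigcupP; exists m => //; apply/finset.bigcupP; exists r; rewrite // inE CM.
apply: (@le_trans _ _ (\sum_(m < n.*2.+1) \sum_(r : m.-tuple 'I_q) #|D m r|)%:R).
  rewrite ler_nat; apply: leq_trans (subset_leq_card sub) _.
  apply: leq_trans (leq_card_bigcup _ _ _ _ _) _.
  by apply: leq_sum => m _; apply: leq_card_bigcup.
apply: (@le_trans _ _ (\sum_(m < n.*2.+1) q%:R ^+ m * X)).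
  rewrite natr_sum; apply: ler_sum => m _; rewrite natr_sum.
  apply: le_trans (ler_sum _ (fun r _ => HD m r)) _.
  by rewrite sumr_const card_tuple card_ord -[leLHS]mulr_natl natrX.
rewrite -mulr_suml ler_wpM2r // -natrX.
have -> : \sum_(m < n.*2.+1) q%:R ^+ m = (\sum_(m < n.*2.+1) q ^ m)%:R :> RR.
  by rewrite natr_sum; apply: eq_bigr => m _; rewrite natrX.
by rewrite ler_nat sum_expn_leq; lia.
Qed.

Lemma list_decodable0 (q n L : nat) (rad : RR) :
  list_decodable rad L (finset.set0 : {set n.-tuple 'I_q}).
Proof.
by move=> m _ r; rewrite eq_card0 // => c; rewrite !inE.
Qed.

(** Passes from the failure probability to the success probability; with counts in place of
    quotients it also covers sizes [M] that no code has. *)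
Lemma list_decodable_compl (q n M L : nat) (rad p : RR) :
  #|[set C : {set n.-tuple 'I_q} | (#|C| == M) && ~~ `[< list_decodable rad L C >]]|%:R
    <= p * 'C(q ^ n, M)%:R ->
  (1 - p) * #|[set C : {set n.-tuple 'I_q} | #|C| == M]|%:R
    <= #|[set C : {set n.-tuple 'I_q} | (#|C| == M) && `[< list_decodable rad L C >]]|%:R.
Proof.
set G := [set C | _ && `[< _ >]]; set W := [set C | _ && ~~ _] => HW.
set A := [set C | _].
have cA : #|A| = 'C(q ^ n, M) by rewrite card_draws card_tuple card_ord.
have AGW : (#|A| <= #|G| + #|W|)%N.
  apply: leq_trans (leq_card_setU _ _); apply/subset_leq_card/fintype.subsetP => C.
  by rewrite !inE => ->; case: `[< _ >].
move: AGW; rewrite -(ler_nat RR) natrD => AGW.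
rewrite -cA in HW; lra.
Qed.

(** In units of [n * ln q], the power of [X] contributes at most [-(L + 1) * e / 2 <= -4], while the
    centres contribute at most 3 because [2 * n + 1 <= 3 * n]. This fixes the constant 8. *)
Lemma union_bound_decay (q n L : nat) (e X : RR) : (3 <= q)%N -> (0 < n)%N -> 0 < e ->
  8 / e <= L.+1%:R -> 0 <= X -> X <= expR (- (e * ln q%:R / 2 * n%:R)) ->
  q%:R ^+ n.*2.+1 * X ^+ L.+1 <= q%:R ^- n.
Proof.
move=> q3 n0 e0 HL X0 HX.
have q0 : 0 < q%:R :> RR by rewrite ltr0n; lia.
have l0 := lnq_gt0 q q3.
have n1 : 1 <= n%:R :> RR by rewrite ler1n.
have He : 8 <= L.+1%:R * e by rewrite -ler_pdivrMr.
have HXL : X ^+ L.+1 <= expR (- (4 * n%:R * ln q%:R)).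
  apply: (@le_trans _ _ (expR (- (e * ln q%:R / 2 * n%:R)) ^+ L.+1)).
    by rewrite lerXn2r // nnegrE // expR_ge0.
  rewrite -expRM_natl ler_expR mulrN lerN2.
  have -> : L.+1%:R * (e * ln q%:R / 2 * n%:R) = L.+1%:R * e / 2 * (n%:R * ln q%:R) by field.
  by rewrite -mulrA ler_wpM2r ?mulr_ge0 ?(ltW l0) //; lra.
rewrite !(expr_expR_ln q%:R) // -expRN; apply: (@le_trans _ _
   (expR (n.*2.+1%:R * ln q%:R) * expR (- (4 * n%:R * ln q%:R)))).
  by rewrite ler_pM2l // expR_gt0.
rewrite -exp.expRD ler_expR -addn1 -addnn !natrD.
have : ln q%:R <= n%:R * ln q%:R :> RR by rewrite -[leLHS]mul1r ler_wpM2r // ltW.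
lra.
Qed.

Theorem mainTheorem1 :
  forall (q : nat), (3 <= q)%N ->
  forall tau : RR, 0 <= tau -> tau < (q%:R - 1) + (q%:R - 1) / q%:R ->
  exists c : RR, 0 < c /\
  exists eps0 : RR, 0 < eps0 /\
  forall eps : RR, 0 < eps -> eps < 1 -> eps < eps0 ->
  exists L : nat, L%:R <= c / eps /\
  exists N : nat, forall n : nat, (N <= n)%N ->
    let Msz := code_size q n (rate_bound q tau - eps) in
    (1 - (q%:R : RR) ^- n) * (#|[set C : {set n.-tuple 'I_q} | #|C| == Msz]|)%:R
      <= (#|[set C : {set n.-tuple 'I_q} |
              (#|C| == Msz) && `[< list_decodable (tau * n%:R) L C >] ]|)%:R.
Proof.
move=> q q3 tau t0 t1.
have q2 : (2 <= q)%N by lia.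
have q0 : 0 < q%:R :> RR by rewrite ltr0n; lia.
have l0 := lnq_gt0 q q3.
exists 8; split=> //; exists 1; split=> // e e0 _ _.
have d0 : 0 <= 8 / e by rewrite divr_ge0 // ltW.
exists (Num.truncn (8 / e)); split; first by rewrite truncn_le.
set L := Num.truncn _; have HL : 8 / e <= L.+1%:R by apply/ltW/truncnS_gt.
(* At a negative rate the size truncates to 0, and the empty code is list-decodable. *)
have [R0|R0] := ltP (rate_bound q tau - e) 0.
  exists 1%N => n n0; rewrite code_size0 //=; apply: list_decodable_compl.
  rewrite eq_card0 ?mulr_ge0 ?invr_ge0 ?exprn_ge0 // => C; rewrite inE cards_eq0.
  by apply/negbTE/negP => /andP [/eqP -> /asboolPn []]; exact: list_decodable0.
have Rp : 0 < rate_bound q tau by lra.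
have tq : tau < (q%:R - 1) / q%:R.
  by rewrite ltNge; apply/negP => H; have := rate_bound_le0 q tau q3 H t1; lra.
have tlt1 : tau < 1 by apply: lt_trans tq _; rewrite ltr_pdivrMr //; lra.
(* Half of [e] absorbs the polynomial factor [n + 1]; the other half is left as decay. *)
have e2 : 0 < e * ln q%:R / 2 by rewrite divr_gt0 // mulr_gt0.
have [N HN] := linear_le_expR _ e2.
exists (maxn N 1) => n; rewrite geq_max => /andP [Nn n0]; set M := code_size _ _ _; cbv zeta.
apply: list_decodable_compl.
have ball m (r : m.-tuple 'I_q) := card_insdel_ball q n m tau (rate_bound q tau) r q3 n0 tq
  (fun k => rate_bound_le_obj q tau k q3 tq Rp).
apply: le_trans (card_not_list_decodable q n L M tau _ q3 tlt1 ball) _.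
rewrite mulrCA mulrC; apply: ler_wpM2r => //.
apply: (union_bound_decay q n L e) => //.
(* In units of [n * ln q] the exponents are [e / 2], [1 - rate_bound] and [rate_bound - e]; after
   division by [q ^ n] they sum to [- e / 2]. *)
rewrite ler_pdivrMr ?exprn_gt0 // expr_expR_ln // -exp.expRD.
apply: (@le_trans _ _ (expR (e * ln q%:R / 2 * n%:R)
   * expR (n%:R * ((1 - rate_bound q tau) * ln q%:R))
   * expR (n%:R * ((rate_bound q tau - e) * ln q%:R)))).
  apply: ler_pM; rewrite ?mulr_ge0 ?expR_ge0 //; last exact: code_size_le.
  by rewrite ler_wpM2r ?expR_ge0 // HN.
by rewrite -!exp.expRD ler_expR; lra.
Qed.
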